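(* Let $R_n$ be any bounded relaxation of $\mathrm{QAP}_n$ (a polytope in $\mathbb{R}^{n^2\times n^2}$ containing $\mathrm{QAP}_n$) such that all inequalities $$\sum_{r=1}^{m}Y_{i_rj_r,kl}-Y_{kl,kl}-\sum_{1\leqslant r<s\leqslant m}Y_{i_rj_r,i_sj_s}\leqslant 0,$$ with $n\geqslant 6$, $m\geqslant 3$, $i_1,\dots,i_m,k\in[n]$ all distinct and $j_1,\dots,j_m,l\in[n]$ all distinct, are valid for $R_n$. Then $\mathrm{xc}(R_n)\geqslant 2^{\Omega(n)}$.
   Context: $P_\sigma$ is the $n\times n$ permutation matrix of $\sigma\in S_n$ ($P_\sigma(i,j)=1$ iff $\sigma(i)=j$). Matrices in $\mathbb{R}^{n^2\times n^2}$ have rows and columns indexed by pairs $(ij)$, $i,j\in[n]$; $Y_{ij,kl}$ is the entry in row $(ij)$, column $(kl)$. $P^{[2]}_\sigma(ij,kl)=P_\sigma(i,j)P_\sigma(k,l)$ and $\mathrm{QAP}_n=\mathrm{conv}\{P^{[2]}_\sigma:\sigma\in S_n\}$. A polytope $Q\subset\mathbb{R}^{d+r}$ is an extension of a polytope $P\subset\mathbb{R}^d$ if $P=\{x:\exists y,\ (x,y)\in Q\}$; the extension complexity $\mathrm{xc}(P)$ is the minimum number of facets of an extension of $P$. *)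

(* Defs.v *)
From HB Require Import structures.
From mathcomp Require Export all_boot all_order all_algebra.
From mathcomp Require Export fingroup perm.
From mathcomp Require Export all_classical all_reals all_analysis.
Export Order.TTheory GRing.Theory Num.Theory.
Export numFieldNormedType.Exports.

Set Implicit Arguments.
Unset Strict Implicit.
Unset Printing Implicit Defensive.

#[export] Set Implicit Arguments.
#[export] Unset Strict Implicit.
#[export] Unset Printing Implicit Defensive.

Global Open Scope classical_set_scope.
Global Open Scope ring_scope.
Local Open Scope card_scope.

Definition conv (R : realType) (V : lmodType R) (A : set V) : set V :=
  [set x | exists (p : nat) (v : 'I_p -> V) (w : 'I_p -> R),
     [/\ forall i, A (v i), forall i, 0 <= w i, \sum_i w i = 1
       & x = \sum_i w i *: v i]].

Section Polytopes.
Variable R : realType.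

(* Points of R^d are row vectors, so a linear system reads x *m A <= b. *)
Definition polyhedron (d : nat) (P : set 'rV[R]_d) : Prop :=
  exists (p : nat) (A : 'M[R]_(d, p)) (b : 'rV[R]_p),
    P = [set x | forall i, (x *m A) 0 i <= b 0 i].

Definition polytope (d : nat) (P : set 'rV[R]_d) : Prop :=
  polyhedron P /\ bounded_set P.

Definition face (d : nat) (P F : set 'rV[R]_d) : Prop :=
  exists (a : 'cV[R]_d) (b : R),
    (forall x, P x -> (x *m a) 0 0 <= b) /\
    F = P `&` [set x | (x *m a) 0 0 = b].

(* Proper faces are nonempty: a single point has no facets. *)
Definition proper_face (d : nat) (P F : set 'rV[R]_d) : Prop :=
  [/\ face P F, F <> set0 & F <> P].

Definition facets (d : nat) (P : set 'rV[R]_d) : set (set 'rV[R]_d) :=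
  [set F | proper_face P F /\
           forall G, proper_face P G -> F `<=` G -> G = F].

Definition extension (d r : nat) (P : set 'rV[R]_d) (Q : set 'rV[R]_(d + r)) :
    Prop :=
  polytope Q /\ P = [set x | exists y : 'rV[R]_r, Q (row_mx x y)].

Definition extension_sizes (d : nat) (P : set 'rV[R]_d) : set nat :=
  [set k | exists (r : nat) (Q : set 'rV[R]_(d + r)),
     extension P Q /\ facets Q #= `I_k].

(* The least element of extension_sizes P; the default 0 is only taken when
   that set is empty, which never happens for a polytope P. *)
Definition xc (d : nat) (P : set 'rV[R]_d) : nat :=
  xget 0%N [set k | extension_sizes P k /\
                    forall k', extension_sizes P k' -> (k <= k')%N].

End Polytopes.

Section QuadraticAssignment.
Variables (R : realType) (n : nat).

Definition entry (Y : 'M[R]_(n * n)) (i j k l : 'I_n) : R :=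
  Y (mxvec_index i j) (mxvec_index k l).

(* The (ij, kl) entry is perm_mx s i j * perm_mx s k l, where
   perm_mx s i j = (s i == j)%:R. *)
Definition perm2_mx (s : 'S_n) : 'M[R]_(n * n) :=
  \matrix_(p, q) (mxvec (perm_mx s) 0 p * mxvec (perm_mx s) 0 q).

Definition QAP : set 'M[R]_(n * n) := conv (range perm2_mx).

Definition valid_inequalities (S : set 'M[R]_(n * n)) : Prop :=
  forall (m : nat) (i j : 'I_m -> 'I_n) (k l : 'I_n),
    (3 <= m)%N ->
    injective i -> (forall r, i r != k) ->
    injective j -> (forall r, j r != l) ->
    forall Y, S Y ->
      \sum_(r < m) entry Y (i r) (j r) k l - entry Y k l k l
      - \sum_(r < m) \sum_(s < m | (r < s)%N)
          entry Y (i r) (j r) (i s) (j s) <= 0.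

End QuadraticAssignment.

Arguments QAP : clear implicits.

(* Main.v *)
Require Import Defs.
From mathcomp Require Import zify ring lra.

(** An inequality [a] valid for [R_n] cuts out a face [G_a] of any extension [Q],
    and a permutation matrix lifts to a point [y_b] of [Q].  Since a proper face
    of [Q] is the intersection of the facets containing it, the facets [F] of [Q]
    yield rectangles [{a | G_a <= F} x {b | y_b notin F}] covering the support of
    the slack matrix.  On suitable block permutations with [s k = l] the
    inequality indexed by a set [a] has slack [1] when [a] and [b] are disjoint
    and [0] when they meet in one element, and by the argument of Kaibel and
    Weltge at least [(3/2)^N] rectangles are needed to cover the [3^N] disjoint
    pairs while avoiding the pairs with a single common element. *)

(** * Rectangle coverings of the disjoint pairs of sets *)

Section DisjointPairs.

Definition inter (a b : seq bool) : nat :=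
  count (fun p => p.1 && p.2) (zip a b).

(* Sum of [F a b] over the pairs [(a, b)] of disjoint subsets of an
   [n]-element set, encoded by their indicator sequences. *)
Fixpoint disjoint_sum (n : nat) (F : seq bool -> seq bool -> nat) : nat :=
  if n is m.+1 then
    (disjoint_sum m (fun a b => F (false :: a) (false :: b)) +
     disjoint_sum m (fun a b => F (true :: a) (false :: b)) +
     disjoint_sum m (fun a b => F (false :: a) (true :: b)))%N
  else F [::] [::].

Lemma disjoint_sumD n F G :
  disjoint_sum n (fun a b => F a b + G a b)%N =
  (disjoint_sum n F + disjoint_sum n G)%N.
Proof. by elim: n F G => //= n IH F G; rewrite !IH; lia. Qed.

Lemma disjoint_sum_sum n k (F : 'I_k -> seq bool -> seq bool -> nat) :
  disjoint_sum n (fun a b => \sum_i F i a b)%N =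
  (\sum_i disjoint_sum n (F i))%N.
Proof.
elim: n F => //= n IH F.
by rewrite (IH (fun i a b => F i (false :: a) (false :: b)))
  (IH (fun i a b => F i (true :: a) (false :: b)))
  (IH (fun i a b => F i (false :: a) (true :: b))) !big_split.
Qed.

Lemma leq_disjoint_sum n F G :
  (forall a b, size a = n -> size b = n -> inter a b = 0%N ->
     F a b <= G a b)%N ->
  (disjoint_sum n F <= disjoint_sum n G)%N.
Proof.
elim: n F G => [|n IH] F G FG /=; first exact: FG.
by rewrite !leq_add //; apply: IH => a b sa sb ab; apply: FG => //=;
  rewrite ?sa ?sb.
Qed.

Lemma disjoint_sum1 n : disjoint_sum n (fun _ _ => 1%N) = (3 ^ n)%N.
Proof. by elim: n => //= n ->; rewrite expnS; lia. Qed.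

(* A pair [(a, b)] of subsets of the first [n] elements has at most two of its
   three disjoint extensions in the rectangle, since otherwise the extension by
   the new element on both sides would meet in exactly one element.  The two
   rectangles of the induction step account for these. *)
Lemma disjoint_sum_rectangle n (A B : pred (seq bool)) :
  (forall a b, size a = n -> size b = n -> A a -> B b -> inter a b <> 1%N) ->
  (disjoint_sum n (fun a b => A a && B b : nat) <= 2 ^ n)%N.
Proof.
elim: n A B => [|n IH] A B AB /=; first by rewrite expn0 leq_b1.
pose A0 a := A (false :: a); pose A1 a := A (true :: a).
pose B0 b := B (false :: b); pose B1 b := B (true :: b).
have h1 : (disjoint_sum n (fun a b => (A0 a || A1 a) && B0 b : nat)
           <= 2 ^ n)%N.
  by apply: IH => a b sa sb /orP[Aa|Aa] Bb;
    apply: (AB _ _ _ _ Aa Bb); rewrite /= ?sa ?sb.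
have h2 : (disjoint_sum n (fun a b => A0 a && (B0 b || B1 b) : nat)
           <= 2 ^ n)%N.
  by apply: IH => a b sa sb Aa /orP[Bb|Bb];
    apply: (AB _ _ _ _ Aa Bb); rewrite /= ?sa ?sb.
rewrite expnS mul2n -addnn; apply: leq_trans (leq_add h1 h2).
rewrite -!disjoint_sumD; apply: leq_disjoint_sum => a b sa sb ab.
have : ~~ (A1 a && B1 b).
  apply/negP => /andP[Aa Bb]; apply: (AB _ _ _ _ Aa Bb); rewrite /= ?sa ?sb //.
  by move: ab; rewrite /inter /= => ->.
by rewrite -/(A0 a) -/(A1 a) -/(B0 b) -/(B1 b);
  case: (A0 a) (A1 a) (B0 b) (B1 b) => [] [] [] [].
Qed.

(** Double counting: each of the [3 ^ n] disjoint pairs lies in some rectangle, and each rectangle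
    contains at most [2 ^ n] of them. *)
Lemma rectangle_covering_bound n k (A B : 'I_k -> pred (seq bool)) :
  (forall i a b, size a = n -> size b = n -> A i a -> B i b ->
     inter a b <> 1%N) ->
  (forall a b, size a = n -> size b = n -> inter a b = 0%N ->
     exists i, A i a && B i b) ->
  (3 ^ n <= k * 2 ^ n)%N.
Proof.
move=> AB cover; rewrite -disjoint_sum1.
apply: (@leq_trans
  (disjoint_sum n (fun a b => \sum_(i < k) (A i a && B i b : nat))%N)).
  apply: leq_disjoint_sum => a b sa sb /(cover _ _ sa sb)[i ABi].
  by rewrite (bigD1 i) //= ABi.
rewrite (disjoint_sum_sum n (fun i a b => A i a && B i b : nat)).
rewrite -[X in (_ <= X * _)%N]card_ord -sum_nat_const; apply: leq_sum => i _.
exact: disjoint_sum_rectangle (AB i).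
Qed.

End DisjointPairs.

(** * Faces and facets of a system of linear inequalities *)

Section Faces.
Variables (R : realType) (d p : nat) (A : 'M[R]_(d, p)) (b : 'rV[R]_p).
Implicit Types (x y : 'rV[R]_d) (i j : 'I_p) (J : {set 'I_p})
  (G F : set 'rV[R]_d).

Definition slack x i := b 0 i - (x *m A) 0 i.

Definition subsystem J : set 'rV[R]_d :=
  [set x | forall i, i \in J -> (x *m A) 0 i <= b 0 i].

Lemma slack_line x y e i :
  slack (x + e *: (y - x)) i = (1 - e) * slack x i + e * slack y i.
Proof.
rewrite /slack mulmxDl -scalemxAl mulmxBl.
by move: (x *m A) (y *m A) => u v; rewrite !mxE; ring.
Qed.

Lemma subsystemP J x : subsystem J x <-> forall i, i \in J -> 0 <= slack x i.
Proof. by split=> h i /h; rewrite subr_ge0. Qed.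

Lemma tightP x i : (x *m A) 0 i = b 0 i <-> slack x i = 0.
Proof.
by rewrite /slack; split=> [->|/eqP]; rewrite ?subrr // subr_eq0 => /eqP.
Qed.

Definition tight J G i := i \in J /\ forall x, G x -> slack x i = 0.

Lemma face_line J G x y e : face (subsystem J) G -> G x -> G y ->
  0 <= e <= 1 -> G (x + e *: (y - x)).
Proof.
move=> [c [v [cv ->]]] [/subsystemP Jx /= cx] [/subsystemP Jy /= cy].
move=> /andP[e0 e1]; split.
  apply/subsystemP => i iJ; have x0 := Jx _ iJ; have y0 := Jy _ iJ.
  by rewrite slack_line addr_ge0 // mulr_ge0 // subr_ge0.
rewrite /= mulmxDl -scalemxAl mulmxBl; move: cx cy.
by move: (x *m c) (y *m c) => u w cx cy; rewrite !mxE cx cy; ring.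
Qed.

(** Rows are treated one at a time: for a row that is not tight on [G], the midpoint with a point of
    positive slack gains that row and keeps all earlier positive slacks positive. *)
Lemma face_relint J G : face (subsystem J) G -> G !=set0 ->
  exists2 x, G x & forall i, i \in J -> tight J G i \/ 0 < slack x i.
Proof.
move=> fG [x0 Gx0].
have GJ x : G x -> subsystem J x by case: fG => c [v [_ ->]] [].
suff : forall s : seq 'I_p, exists2 x, G x & forall i, i \in s -> i \in J ->
    tight J G i \/ 0 < slack x i.
  by move=> /(_ (enum 'I_p))[x Gx h]; exists x => // i; apply: h; rewrite mem_enum.
elim=> [|j s [x Gx h]]; first by exists x0.
have [[jJ ntj]|tj] := pselect (j \in J /\ ~ tight J G j); last first.
  exists x => // i; rewrite inE => /orP[/eqP ->|]; last exact: h.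
  by move=> jJ; left; apply: contrapT => ntj; exact: tj.
have [y Gy yj] : exists2 y, G y & 0 < slack y j.
  apply: contrapT => ny; apply: ntj; split=> // y Gy; apply/eqP.
  rewrite eq_le; have /subsystemP/(_ _ jJ) -> := GJ _ Gy.
  by rewrite andbT leNgt; apply/negP => yj; apply: ny; exists y.
exists (x + 2^-1 *: (y - x)).
  by apply: face_line fG _ _ _ => //; lra.
move=> i; rewrite inE => is_ iJ; rewrite slack_line.
have xi0 : 0 <= slack x i by have /subsystemP := GJ _ Gx; apply.
have yi0 : 0 <= slack y i by have /subsystemP := GJ _ Gy; apply.
case/orP: is_ => [/eqP ij|/h/(_ iJ)[ti|xi]]; last 2 first.
- by left.
- by right; lra.
- by right; move: xi0 yi0 yj; rewrite ij; lra.
Qed.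

(** The slack at the new point is [(1 + e) * slack x i - e * slack y i], so it suffices that
    [e * slack y i <= slack x i] for the finitely many rows of [J]. *)
Lemma subsystem_prolong J x y : subsystem J x -> subsystem J y ->
  (forall i, i \in J -> 0 < slack x i \/ slack y i = 0) ->
  exists2 e, 0 < e & subsystem J (x + e *: (x - y)).
Proof.
move=> /subsystemP Jx /subsystemP Jy xy.
suff : forall s : seq 'I_p, exists2 e, 0 < e & forall i, i \in s -> i \in J ->
    e * slack y i <= slack x i.
  move=> /(_ (enum 'I_p))[e e0 he]; exists e => //.
  apply/subsystemP => i iJ; rewrite -opprB scalerN -scaleNr slack_line.
  have := he i; rewrite mem_enum => /(_ isT iJ); have := Jx _ iJ => x0.
  by have := mulr_ge0 (ltW e0) x0; lra.
elim=> [|j s [e e0 he]]; first by exists 1.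
have [jJ|njJ] := boolP (j \in J); last first.
  by exists e => // i; rewrite inE => /orP[/eqP ->|]; [rewrite (negbTE njJ)|exact: he].
have [e' e'0 he'] : exists2 e', 0 < e' & e' * slack y j <= slack x j.
  have := Jy _ jJ; rewrite le_eqVlt => /orP[/eqP y0|y0].
    by exists 1; rewrite // -y0 mulr0 Jx.
  case: (xy _ jJ) => [x0|y0']; last by rewrite y0' ltxx in y0.
  by exists (slack x j / slack y j); rewrite ?divr_gt0 // divfK // gt_eqF.
exists (Num.min e e'); first by rewrite lt_min e0.
move=> i; rewrite inE => /orP[/eqP ->|si] iJ.
  by apply: le_trans he'; rewrite ler_wpM2r ?Jy // ge_min lexx orbT.
by apply: le_trans (he _ si iJ); rewrite ler_wpM2r ?Jy // ge_min lexx.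
Qed.

(* A point [y] of the right-hand side may be pushed through a relative interior
   point of [G] while staying in the polyhedron, so the inequality defining [G]
   cannot be strict at [y]. *)
Lemma face_tightE J G : face (subsystem J) G -> G !=set0 ->
  G = [set y | subsystem J y /\ forall i, tight J G i -> slack y i = 0].
Proof.
move=> fG G0; have [x Gx xJ] := face_relint fG G0.
apply/seteqP; split=> y.
  by move=> Gy; split=> [|i [_]]; [case: fG Gy => c [v [_ ->]] [] | apply].
move=> [Jy ty]; case: (fG) => c [v [cv eG]].
have [Jx /= cx] : (subsystem J `&` [set x | (x *m c) 0 0 = v]) x by rewrite -eG.
have [e e0 /cv] : exists2 e, 0 < e & subsystem J (x + e *: (x - y)).
  apply: subsystem_prolong => // i /xJ[/ty|]; by [right|left].
have -> : ((x + e *: (x - y)) *m c) 0 0 = v + e * (v - (y *m c) 0 0).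
  rewrite mulmxDl -scalemxAl mulmxBl -cx.
  by move: (x *m c) (y *m c) => u w; rewrite !mxE.
rewrite gerDl pmulr_rle0 // subr_le0 => vy; rewrite eG; split=> //=.
by apply/eqP; rewrite eq_le vy cv.
Qed.

Lemma tight_face J j : j \in J ->
  face (subsystem J) (subsystem J `&` [set x | slack x j = 0]).
Proof.
move=> jJ; exists (col j A), (b 0 j).
have e x : (x *m col j A) 0 0 = (x *m A) 0 j by rewrite colE mulmxA -colE mxE.
split=> [x Jx|]; first by rewrite e; exact: Jx.
by apply/seteqP; split=> x [Jx]; rewrite /= ?e => /tightP h; split=> //=;
  rewrite ?e.
Qed.

(** By [face_tightE] a nonempty face is determined by its set of tight rows, and there are finitely
    many such sets. *)
Lemma finite_facets J : finite_set (facets (subsystem J)).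
Proof.
pose f (I : {set 'I_p}) : set 'rV[R]_d :=
  [set y | subsystem J y /\ forall i, i \in I -> slack y i = 0].
have : finite_set (range f) by apply: finite_image; exact: finite_finset.
apply: sub_finite_set => F [[fF /eqP/set0P F0 _] _].
exists [set i | `[< tight J F i >]]%SET => //.
rewrite [RHS](face_tightE fF F0).
apply/seteqP; split=> y [Jy h]; split=> // i.
  by move=> ti; apply: h; rewrite inE; apply/asboolP.
by rewrite inE => /asboolP; apply: h.
Qed.

(* Irredundancy yields a point outside the polyhedron violating only [j]; on its
   segment to a relative interior point lies a point where, apart from implicit
   equations, only [j] is tight. *)
Lemma irredundant_facet J j : j \in J -> subsystem (J :\ j) <> subsystem J ->
  subsystem J !=set0 -> ~ tight J (subsystem J) j ->
  facets (subsystem J) (subsystem J `&` [set x | slack x j = 0]).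
Proof.
move=> jJ irr J0 ntj; set P := subsystem J in irr J0 ntj *.
set F := _ `&` _.
have fP : face P P.
  exists 0, 0; split=> [x _|]; first by rewrite mulmx0 mxE.
  by apply/seteqP; split=> [x Px|x []//]; split=> //=; rewrite mulmx0 mxE.
have [x Px xJ] := face_relint fP J0.
have xj : 0 < slack x j by case: (xJ _ jJ).
have [y yJ yj] : exists2 y, subsystem (J :\ j) y & slack y j < 0.
  apply: contrapT => ny; apply: irr; apply/seteqP; split=> z.
    move=> zJ; apply/subsystemP => i iJ.
    have [->|ij] := eqVneq i j; last first.
      by move/subsystemP: zJ; apply; rewrite !inE ij.
    by rewrite leNgt; apply/negP => zj; apply: ny; exists z.
  by move=> Pz i; rewrite !inE => /andP[_]; exact: Pz.
(* The parameter at which the affine function [slack _ j] vanishes on the segment from [x] to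
   [y]. *)
pose e := slack x j / (slack x j - slack y j).
have D0 : 0 < slack x j - slack y j by lra.
have e0 : 0 < e by rewrite divr_gt0.
have e1 : e < 1 by rewrite ltr_pdivrMr //; lra.
pose z := x + e *: (y - x).
have zj : slack z j = 0.
  by rewrite slack_line /e; field; rewrite gt_eqF.
have yi i : i \in J -> i != j -> 0 <= slack y i.
  by move=> iJ ij; move/subsystemP: yJ; apply; rewrite !inE ij.
have Pz : P z.
  apply/subsystemP => i iJ; have [->|ij] := eqVneq i j; first by rewrite zj.
  have xi0 : 0 <= slack x i by move/subsystemP: Px; apply.
  have yi0 := yi _ iJ ij.
  by rewrite slack_line addr_ge0 // mulr_ge0 // ?subr_ge0 ltW.
have zt i : i \in J -> slack z i = 0 -> i = j \/ tight J P i.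
  move=> iJ zi0; have [->|ij] := eqVneq i j; [by left|right].
  case: (xJ _ iJ) => // xi0.
  have yi0 := yi _ iJ ij.
  have x1 : 0 < (1 - e) * slack x i by rewrite mulr_gt0 // subr_gt0.
  have y1 : 0 <= e * slack y i by rewrite mulr_ge0 // ltW.
  by move: zi0; rewrite slack_line; lra.
have Fz : F z by [].
split.
  split; [exact: tight_face|by move=> eF; rewrite eF in Fz|].
  by move=> eF; move: Px; rewrite -eF => -[_ /= xj0]; rewrite xj0 ltxx in xj.
move=> G [fG /eqP/set0P G0 GP] FG; apply/seteqP; split=> // w Gw.
have Pw : P w by case: fG Gw => c [v [_ ->]] [].
(* Otherwise every row tight on [G] vanishes at [z] and differs from [j], hence is tight on all of
   [P]; then [G = P], against properness. *)
split=> //=; have [[_ tj]|ntGj] := pselect (tight J G j); first exact: tj.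
exfalso; apply: GP; rewrite (face_tightE fG G0).
apply/seteqP; split=> u; first by case.
move=> Pu; split=> // i [iJ tGi]; have [eij|[_ tPi]] := zt i iJ (tGi _ (FG _ Fz)).
  by case: ntGj; rewrite -eij.
exact: tPi.
Qed.

Lemma irredundant_subsystem : exists2 J, subsystem J = subsystem [set: 'I_p]%SET &
  forall j, j \in J -> subsystem (J :\ j) <> subsystem J.
Proof.
pose Q (J : {set 'I_p}) := `[< subsystem J = subsystem [set: 'I_p]%SET >].
have QT : Q [set: 'I_p]%SET by apply/asboolP.
have [J /minsetP[/asboolP QJ minJ] _] := minset_exists QT.
exists J => // j jJ eJ.
have := minJ (J :\ j)%SET; rewrite subsetDl => /(_ _ isT) h.
have : (J :\ j)%SET = J by apply: h; apply/asboolP; rewrite eJ.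
by move=> /setP/(_ j); rewrite !inE eqxx jJ.
Qed.

End Faces.

(** * Separating a face from a point by a facet *)

Section Polyhedra.
Variables (R : realType) (d : nat) (P : set 'rV[R]_d).
Hypothesis polyP : polyhedron P.

Lemma polyhedron_subsystem : exists (p : nat) (A : 'M[R]_(d, p)) (b : 'rV[R]_p)
  (J : {set 'I_p}), P = subsystem A b J /\
  forall j, j \in J -> subsystem A b (J :\ j) <> subsystem A b J.
Proof.
case: polyP => p [A [b eP]]; have [J eJ irr] := irredundant_subsystem A b.
exists p, A, b, J; split=> //; rewrite eJ eP.
by apply/seteqP; split=> x h i; have := h i; rewrite inE //; apply.
Qed.

Lemma polyhedron_finite_facets : finite_set (facets P).
Proof.
by have [p [A [b [J [-> _]]]]] := polyhedron_subsystem; exact: finite_facets.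
Qed.

(** Some row tight on [G] has nonzero slack at [y]. As [y] lies in [P], this row is not an implicit
    equation of [P], so in an irredundant system it defines a facet. *)
Lemma facet_separation G y : face P G -> G !=set0 -> P y -> ~ G y ->
  exists F, [/\ facets P F, G `<=` F & ~ F y].
Proof.
have [p [A [b [J [-> irr]]]]] := polyhedron_subsystem => fG G0 Py nGy.
have [j tj yj] : exists2 j, tight A b J G j & slack A b y j <> 0.
  apply: contrapT => nj; apply: nGy; rewrite (face_tightE fG G0); split=> // i ti.
  by apply: contrapT => yi; apply: nj; exists i.
have jJ := tj.1.
exists (subsystem A b J `&` [set x | slack A b x j = 0]); split.
- apply: irredundant_facet (irr _ jJ) _ _ => //; first by exists y.
  by move=> [_ /(_ _ Py)].
- move=> x Gx; split; last exact: tj.2.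
  by case: fG Gx => c [v [_ ->]] [].
- by case.
Qed.

End Polyhedra.

(** * Lower bounds on the size of an extension *)

Section ExtensionComplexity.
Variable R : realType.

Lemma polytope_castmx d d' (e : d = d') (P : set 'rV[R]_d) : polytope P ->
  polytope [set z : 'rV[R]_d' | P (castmx (erefl, esym e) z)].
Proof.
by case: _ / e.
Qed.

(** The polytope is an extension of itself with no extra coordinates, up to the cast between [d] and
    [d + 0]. *)
Lemma extension_sizes_neq0 d (P : set 'rV[R]_d) : polytope P ->
  extension_sizes P !=set0.
Proof.
move=> polyP; have polyQ := polytope_castmx (esym (addn0 d)) polyP.
have [k kP] := polyhedron_finite_facets polyQ.1.
exists k, 0%N; eexists; split; last exact: kP.
split=> //.
have cast_row (x : 'rV[R]_d) (y : 'rV[R]_0) :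
    castmx (erefl, esym (esym (addn0 d))) (row_mx x y) = x.
  apply/rowP => i; rewrite castmxE /= -[RHS](row_mxEl x y).
  by congr (row_mx x y _ _); apply: val_inj; rewrite //= ord1.
by apply/seteqP; split=> x /=; [exists 0; rewrite cast_row | case=> y; rewrite cast_row].
Qed.

Lemma xc_extension_sizes d (P : set 'rV[R]_d) : polytope P ->
  extension_sizes P (xc P).
Proof.
move=> /extension_sizes_neq0/nat_has_minimum[k kP].
by rewrite /xc; case: xgetP => [_ _ []//|/(_ k)].
Qed.

(* Every facet [F] of an extension gives a rectangle, namely the inequalities
   whose face lies in [F] times the points whose lift avoids [F]; these
   rectangles cover the support of the slack matrix. *)
Lemma extension_size_unique_disjointness d (P : set 'rV[R]_d) n
    (c : seq bool -> 'cV[R]_d) (delta : seq bool -> R)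
    (v : seq bool -> 'rV[R]_d) k :
  (forall a x, size a = n -> P x -> (x *m c a) 0 0 <= delta a) ->
  (forall a, size a = n -> exists2 x, P x & (x *m c a) 0 0 = delta a) ->
  (forall b, size b = n -> P (v b)) ->
  (forall a b, size a = n -> size b = n -> inter a b = 1%N ->
     (v b *m c a) 0 0 = delta a) ->
  (forall a b, size a = n -> size b = n -> inter a b = 0%N ->
     (v b *m c a) 0 0 <> delta a) ->
  extension_sizes P k -> (3 ^ n <= k * 2 ^ n)%N.
Proof.
move=> valid tight_ex Pv v_tight v_slack [r [Q [[[polyQ _] PQ] cardQ]]].
pose G a := Q `&` [set z | (z *m col_mx (c a) 0) 0 0 = delta a].
have cE a (z : 'rV[R]_(d + r)) :
    (z *m col_mx (c a) 0) 0 0 = (lsubmx z *m c a) 0 0.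
  by rewrite -[z in LHS]hsubmxK mul_row_col mulmx0 addr0.
have QP z : Q z -> P (lsubmx z).
  by move=> Qz; rewrite PQ; exists (rsubmx z); rewrite hsubmxK.
have faceG a : size a = n -> face Q (G a).
  move=> sa; exists (col_mx (c a) 0), (delta a); split=> // z Qz.
  by rewrite cE; apply: valid => //; exact: QP.
(* Attainment of the bound in [P] gives the nonemptiness that [facet_separation] requires. *)
have G0 a : size a = n -> G a !=set0.
  move=> /tight_ex[x]; rewrite PQ => -[y Qxy] xa; exists (row_mx x y).
  by split=> //=; rewrite cE row_mxKl.
move: cardQ; rewrite card_eq_sym => /card_set_bijP[F [_ _ surjF]].
apply: (@rectangle_covering_bound n k
  (fun i a => `[< G a `<=` F i >])
  (fun i b => `[< exists y, Q (row_mx (v b) y) /\ ~ F i (row_mx (v b) y) >])).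
  move=> i a b sa sb /asboolP GF /asboolP[y [Qy nFy]] ab; apply/nFy/GF.
  by split=> //=; rewrite cE row_mxKl; exact: v_tight.
move=> a b sa sb ab; have := Pv _ sb; rewrite PQ => -[y Qy].
have nGy : ~ G a (row_mx (v b) y).
  by move=> [_ /=]; rewrite cE row_mxKl; exact: v_slack.
have [F' [/surjF[i ik <-] GF nFy]] :=
  facet_separation polyQ (faceG _ sa) (G0 _ sa) Qy nGy.
exists (Ordinal ik); apply/andP; split; apply/asboolP => //.
by exists y.
Qed.

End ExtensionComplexity.

(** * The inequalities as linear functionals, and their values at permutations *)

Section InequalityVectors.
Variables (R : realType) (n m : nat) (i j : 'I_m -> 'I_n) (k l : 'I_n).

Definition ineq_value (Y : 'M[R]_(n * n)) : R :=
  \sum_(r < m) entry Y (i r) (j r) k l - entry Y k l k l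
  - \sum_(r < m) \sum_(s < m | (r < s)%N)
      entry Y (i r) (j r) (i s) (j s).

Definition entry_col (i j k l : 'I_n) : 'cV[R]_(n * n * (n * n)) :=
  delta_mx (mxvec_index (mxvec_index i j) (mxvec_index k l)) 0.

Definition ineq_col : 'cV[R]_(n * n * (n * n)) :=
  \sum_(r < m) entry_col (i r) (j r) k l - entry_col k l k l
  - \sum_(r < m) \sum_(s < m | (r < s)%N)
      entry_col (i r) (j r) (i s) (j s).

Lemma mulmx_entry_col Y i' j' k' l' :
  (mxvec Y *m entry_col i' j' k' l') 0 0 = entry Y i' j' k' l'.
Proof. by rewrite -colE mxE mxvecE. Qed.

Lemma mulmx_ineq_col Y : (mxvec Y *m ineq_col) 0 0 = ineq_value Y.
Proof.
rewrite /ineq_col /ineq_value !mulmxBr !mulmx_sumr.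
have entB p q (A B : 'M[R]_(p, q)) x y : (A - B) x y = A x y - B x y.
  by rewrite !mxE.
rewrite !entB !summxE mulmx_entry_col; congr (_ - _ - _).
  by apply: eq_bigr => r _; rewrite mulmx_entry_col.
apply: eq_bigr => r _; rewrite mulmx_sumr summxE.
by apply: eq_bigr => s _; rewrite mulmx_entry_col.
Qed.

Lemma entry_perm2_mx (s : 'S_n) i' j' k' l' :
  entry (perm2_mx R s) i' j' k' l' = ((s i' == j') && (s k' == l'))%:R.
Proof. by rewrite /entry /perm2_mx mxE !mxvecE !mxE -natrM mulnb. Qed.

(** A nonzero term of the double sum would need two indices [r] with [s (i r) = j r], so that sum
    vanishes. *)
Lemma ineq_value_perm2_mx (s : 'S_n) : s k = l ->
  (\sum_(r < m) (s (i r) == j r) <= 1)%N ->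
  ineq_value (perm2_mx R s) = (\sum_(r < m) (s (i r) == j r))%N%:R - 1.
Proof.
move=> skl le1; rewrite /ineq_value entry_perm2_mx skl eqxx /=.
rewrite [X in _ - X]big1 ?subr0 => [|r _]; last first.
  apply: big1 => t rt; rewrite entry_perm2_mx.
  case: andP => // -[ri ti]; exfalso; move: le1.
  have tr : t != r by apply: contraTneq rt => ->; rewrite ltnn.
  by rewrite (bigD1 r) //= (bigD1 t) //= ri ti.
rewrite natr_sum; congr (_ - _); apply: eq_bigr => r _.
by rewrite entry_perm2_mx skl eqxx andbT.
Qed.

End InequalityVectors.

(** * Permutations encoding sets *)

Lemma inter_nseq_false a : inter a (nseq (size a) false) = 0%N.
Proof. by elim: a => // x a; rewrite /inter /= andbF. Qed.

Lemma interE m a b : size a = m -> size b = m ->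
  inter a b = (\sum_(r < m) (nth false a r && nth false b r))%N.
Proof.
elim: m a b => [|m IH] [|x a] [|y b] //=; first by rewrite big_ord0.
by move=> [sa] [sb]; rewrite big_ord_recl /= -IH.
Qed.

(* Row [r < m] is mapped to column [r] or [m + r] according to [b], hence never
   to column [2 m + r]; the index [3 m] is fixed. *)
Section BlockPermutations.
Variables (n m : nat).
Hypothesis mn : (3 * m < n)%N.

Definition block_swap (b : seq bool) (x : nat) : nat :=
  if (x < m)%N then (if nth false b x then x else x + m)%N
  else if (x < 2 * m)%N then (if nth false b (x - m) then x else x - m)%N
  else x.

Lemma block_swapK b : involutive (block_swap b).
Proof.
move=> x; rewrite /block_swap.
case: (ltnP x m) => xm.
  case E : (nth false b x); first by rewrite xm E.
  have -> : (x + m < m)%N = false by lia.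
  have -> : (x + m < 2 * m)%N by lia.
  by rewrite addnK E.
case: (ltnP x (2 * m)) => x2m; last by rewrite !ltnNge xm x2m.
case E : (nth false b (x - m)); first by rewrite ltnNge xm x2m E.
have -> : (x - m < m)%N by lia.
by rewrite E subnK.
Qed.

Lemma block_swap_lt b (x : 'I_n) : (block_swap b x < n)%N.
Proof.
have xn := ltn_ord x; rewrite /block_swap.
by case: (ltnP x m) => ?; [|case: (ltnP x (2 * m)) => ?]; try case: (nth _ _ _); lia.
Qed.

Definition block_fun b (x : 'I_n) : 'I_n := Ordinal (block_swap_lt b x).

Lemma block_fun_inj b : injective (block_fun b).
Proof.
move=> x y /(congr1 val) /= /(can_inj (block_swapK b)).
exact: val_inj.
Qed.

Definition block_perm b : 'S_n := perm (@block_fun_inj b).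

Lemma block_row_subproof (r : 'I_m) : (r < n)%N.
Proof. by have := ltn_ord r; lia. Qed.

Definition block_row (r : 'I_m) : 'I_n := Ordinal (block_row_subproof r).

Lemma block_col_subproof (a : seq bool) (r : 'I_m) :
  ((if nth false a r then r : nat else 2 * m + r) < n)%N.
Proof. by have := ltn_ord r; case: (nth _ _ _); lia. Qed.

Definition block_col a (r : 'I_m) : 'I_n := Ordinal (block_col_subproof a r).

Definition block_pivot : 'I_n := Ordinal mn.

Lemma block_row_inj : injective block_row.
Proof. by move=> r s /(congr1 val) /= /val_inj. Qed.

Lemma block_row_pivot r : block_row r != block_pivot.
Proof. by rewrite -val_eqE /=; have := ltn_ord r; lia. Qed.

Lemma block_col_inj a : injective (block_col a).
Proof.
move=> r s /(congr1 val) /= rs; apply: val_inj => /=.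
by have := ltn_ord r; have := ltn_ord s; move: rs; do 2 case: (nth _ _ _); lia.
Qed.

Lemma block_col_pivot a r : block_col a r != block_pivot.
Proof. by rewrite -val_eqE /=; have := ltn_ord r; case: (nth _ _ _); lia. Qed.

Lemma block_perm_pivot b : block_perm b block_pivot = block_pivot.
Proof.
apply: val_inj; rewrite permE /= /block_swap.
by case: ltnP => ?; [|case: ltnP => ?]; lia.
Qed.

Lemma block_perm_row a b r :
  (block_perm b (block_row r) == block_col a r) =
  nth false a r && nth false b r.
Proof.
rewrite permE -val_eqE /= /block_swap ltn_ord.
by have := ltn_ord r; do 2 case: (nth _ _ _) => /=; lia.
Qed.

Lemma ineq_value_block (R : realType) a b : size a = m -> size b = m ->
  (inter a b <= 1)%N ->
  ineq_value block_row (block_col a) block_pivot block_pivot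
    (perm2_mx R (block_perm b)) = (inter a b)%:R - 1.
Proof.
move=> sa sb; rewrite (interE sa sb).
under [X in (X <= 1)%N -> _]eq_bigr do rewrite -block_perm_row.
under [in X in _ -> _ = X]eq_bigr do rewrite -block_perm_row.
by move=> le1; rewrite ineq_value_perm2_mx ?block_perm_pivot.
Qed.

End BlockPermutations.

(** * The bound for relaxations *)

Lemma conv_sub (R : realType) (V : lmodType R) (A : set V) : A `<=` conv A.
Proof.
move=> x Ax; exists 1%N, (fun=> x), (fun=> 1).
by split=> //; rewrite big_ord1 ?scale1r.
Qed.

Lemma xc_relaxation (R : realType) n N (Rn : set 'M[R]_(n * n)) :
  (2 <= N)%N -> (3 * N.+1 < n)%N ->
  polytope (mxvec @` Rn) -> QAP R n `<=` Rn -> valid_inequalities Rn ->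
  (3 ^ N <= xc (mxvec @` Rn) * 2 ^ N)%N.
Proof.
move=> N2 Nn polyR QAPR valid; set o := block_pivot Nn.
have Rnp b : Rn (perm2_mx R (block_perm Nn b)).
  by apply/QAPR/conv_sub; exists (block_perm Nn b).
(* One extra element is put in every [a] and in no [b]. This leaves [inter a b] unchanged, while the
   permutation of the singleton of that element makes every inequality tight. *)
pose col a := ineq_col R (block_row Nn) (block_col Nn (true :: a)) o o.
pose v b := mxvec (perm2_mx R (block_perm Nn (false :: b))).
have vE a b : size a = N -> size b = N -> (inter a b <= 1)%N ->
    (v b *m col a) 0 0 = (inter a b)%:R - 1.
  move=> sa sb ab; rewrite mulmx_ineq_col.
  by rewrite ineq_value_block /= ?sa ?sb.
apply: (@extension_size_unique_disjointness R _ (mxvec @` Rn) N col (fun=> 0) v).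
- move=> a _ sa [Y RY <-]; rewrite mulmx_ineq_col.
  apply: valid => //.
  + exact: block_row_inj.
  + exact: block_row_pivot.
  + exact: block_col_inj.
  + exact: block_col_pivot.
- move=> a sa.
  have i1 : inter (true :: a) (true :: nseq N false) = 1%N.
    by rewrite -sa; have := inter_nseq_false a; rewrite /inter /= => ->.
  exists (mxvec (perm2_mx R (block_perm Nn (true :: nseq N false)))).
    by apply: imageP; exact: Rnp.
  by rewrite mulmx_ineq_col ineq_value_block ?i1 ?subrr //= ?sa ?size_nseq.
- by move=> b _; apply: imageP; exact: Rnp.
- by move=> a b sa sb ab; rewrite vE // ab ?subrr.
- move=> a b sa sb ab; rewrite vE // ab // sub0r => /eqP.
  by rewrite oppr_eq0 oner_eq0.
- exact: xc_extension_sizes.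
Qed.

Theorem theorem7 (R : realType) :
  exists (c : R) (N : nat), 0 < c /\
    forall n : nat, (6 <= n)%N -> (N <= n)%N ->
    forall Rn : set 'M[R]_(n * n),
      polytope (mxvec @` Rn) ->
      QAP R n `<=` Rn ->
      valid_inequalities Rn ->
      2 `^ (c * n%:R) <= (xc (mxvec @` Rn))%:R.
Proof.
exists 16^-1, 16%N; split=> // n _ n16 Rn polyR QAPR valid.
(* With [2 * q] elements the blocks need [3 * (2 * q + 1) < n], which holds as [8 * q <= n] and
   [2 <= q]. Then [8 ^ q <= 9 ^ q] turns the bound into [2 ^ q], and [n <= 16 * q] gives the
   constant. *)
pose q := (n %/ 8)%N.
have bound : (3 ^ (2 * q) <= xc (mxvec @` Rn) * 2 ^ (2 * q))%N.
  by apply: xc_relaxation => //; rewrite /q; lia.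
have le2q : (2 ^ q <= xc (mxvec @` Rn))%N.
  rewrite -(@leq_pmul2r (2 ^ (2 * q))) ?expn_gt0 //.
  apply: leq_trans bound; rewrite !expnM -expnMn.
  by rewrite leq_exp2r //; rewrite /q; lia.
apply: (@le_trans _ _ (2 `^ q%:R)).
  apply: ler_powR; first by rewrite ler1n.
  rewrite mulrC ler_pdivrMr // -natrM ler_nat /q; lia.
by rewrite powR_mulrn // -natrX ler_nat.
Qed.
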